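(* Let $V_{1}$ and $V_{2}$ be the varieties of bands defined (within the variety of bands) by the identities $zxy\approx zyx$ and $yxz\approx xyz$, respectively. Then $V_1$ and $V_2$ are mutually derived by $\sigma_{4}$, i.e. $(V_{1})_{\sigma_{4}}=V_{2}$ and $(V_{2})_{\sigma_{4}}=V_{1}$. Moreover, $\dim(V_{1})=\dim(V_{2})=1$.
   Context: A band is an idempotent semigroup, viewed as an algebra of type $(2)$ (one binary operation, written as juxtaposition). A hypersubstitution of type $(2)$ is a choice $\sigma$ of a binary term $\sigma(xy)$ in the variables $x,y$; $\sigma_4$ denotes the hypersubstitution with $\sigma_{4}(xy)=yx$. For an algebra $\mathbf{A}=(A,\cdot)$ of type $(2)$ the derived algebra $\mathbf{A}_{\sigma}$ is the set $A$ with the binary term operation induced by $\sigma(xy)$ on $\mathbf{A}$. For a variety $V$ of type $(2)$, the derived variety $V_{\sigma}$ is the variety (of type $(2)$) generated by $\{\mathbf{A}_{\sigma}:\mathbf{A}\in V\}$; it is proper if $V_{\sigma}\neq V$. The dimension $\dim(V)$ is the cardinality of the set of all proper derived varieties $V_{\sigma}$ of $V$ that are included in $V$, where $\sigma$ ranges over all hypersubstitutions of type $(2)$. *)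

(* Defs.v *)
From mathcomp Require Import all_boot.
From mathcomp Require Import boolp classical_sets functions cardinality.

Set Implicit Arguments.
Unset Strict Implicit.
Unset Printing Implicit Defensive.

Local Open Scope classical_set_scope.

(* Algebras of type (2); as usual in universal algebra, universes are nonempty. *)
Record alg2 := Alg2 {
  carrier :> Type;
  op : carrier -> carrier -> carrier;
  carrier_inhabited : inhabited carrier
}.

Inductive term (X : Type) : Type :=
| Var of X
| App of term X & term X.

Fixpoint eval (X : Type) (A : alg2) (v : X -> A) (t : term X) : A :=
  match t with
  | Var x => v x
  | App s t => op (eval v s) (eval v t)
  end.

Definition identity2 : Type := (term nat * term nat)%type.

Definition satisfies (A : alg2) (e : identity2) : Prop :=
  forall v : nat -> A, eval v e.1 = eval v e.2.

Definition models (E : set identity2) : set alg2 :=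
  [set A | forall e, E e -> satisfies A e].

(* Classes of algebras are sets in the sense of classical_sets, so that [=]
   between them is extensional equality. *)
Definition is_variety (V : set alg2) : Prop :=
  exists E : set identity2, V = models E.

Definition generated_variety (K : set alg2) : set alg2 := smallest is_variety K.

(* A hypersubstitution of type (2) is determined by the binary term
   sigma(xy); the variables x and y are the elements 0 and 1 of 'I_2. *)
Definition hypersubst : Type := term 'I_2.

Definition sigma4 : hypersubst := App (Var ord_max) (Var ord0).

Definition term_op (A : alg2) (sigma : hypersubst) (a b : A) : A :=
  eval (fun i : 'I_2 => if i == ord0 then a else b) sigma.

Definition derived_alg (A : alg2) (sigma : hypersubst) : alg2 :=
  Alg2 (@term_op A sigma) (carrier_inhabited A).

Definition derived_variety (V : set alg2) (sigma : hypersubst) : set alg2 :=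
  generated_variety [set derived_alg A sigma | A in V].

Definition proper_derived_subvarieties (V : set alg2) : set (set alg2) :=
  [set W | exists sigma : hypersubst,
     [/\ W = derived_variety V sigma, W <> V & W `<=` V]].

(* dim(V) = n, for a finite cardinal n; `I_n is the set {0, ..., n-1}. *)
Definition has_dim (V : set alg2) (n : nat) : Prop :=
  (proper_derived_subvarieties V #= `I_n)%card.

Definition bands : set alg2 :=
  [set A | associative (@op A) /\ idempotent_op (@op A)].

(* In the identities below, Var 0, Var 1, Var 2 stand for x, y, z; products
   are bracketed to the left, which is immaterial in bands. *)

(* zxy = zyx *)
Definition V1 : set alg2 :=
  [set A | bands A /\
     satisfies A (App (App (Var 2) (Var 0)) (Var 1),
                  App (App (Var 2) (Var 1)) (Var 0))].

(* yxz = xyz *)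
Definition V2 : set alg2 :=
  [set A | bands A /\
     satisfies A (App (App (Var 1) (Var 0)) (Var 2),
                  App (App (Var 0) (Var 1)) (Var 2))].

(* Main.v *)
(** On left normal bands a binary term depends only on its leftmost variable
    and its content, so it coincides with one of [x], [y], [xy], [yx]. The
    corresponding classes of derived algebras of [V1] are the left zero bands,
    the right zero bands, [V1] and [V2]; all are varieties already, and only
    the first is a proper subvariety of [V1]. Right normal bands are the
    opposites of left normal bands, and passing to the opposite is deriving by
    [sigma4]. *)

From mathcomp Require Import all_boot.
From mathcomp Require Import boolp classical_sets cardinality.
Require Import Defs.

Set Implicit Arguments.
Unset Strict Implicit.
Unset Printing Implicit Defensive.

Local Open Scope classical_set_scope.

(** * Derived algebras and opposites *)

Lemma derived_alg_op_eq (A : alg2) (s t : hypersubst) :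
  (forall a b : A, term_op s a b = term_op t a b) ->
  derived_alg A s = derived_alg A t.
Proof.
move=> st; rewrite /derived_alg; congr Alg2.
by apply/funext => a; apply/funext => b.
Qed.

Definition term_xy : hypersubst := App (Var ord0) (Var ord_max).

Lemma derived_alg_xy (A : alg2) : derived_alg A term_xy = A.
Proof. by case: A. Qed.

Definition dual (A : alg2) : alg2 := derived_alg A sigma4.

Lemma dualK : involutive dual.
Proof. by case. Qed.

Fixpoint mirror (X : Type) (t : term X) : term X :=
  match t with
  | Var x => Var x
  | App s t => App (mirror t) (mirror s)
  end.

Lemma eval_dual (X : Type) (A : alg2) (v : X -> A) (t : term X) :
  eval (A := dual A) v t = eval v (mirror t).
Proof. by elim: t => //= s -> t ->. Qed.

Lemma mirrorK (X : Type) : involutive (@mirror X).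
Proof. by elim=> //= s -> t ->. Qed.

(** Evaluation in the opposite algebra reverses every product, so the reversal can be moved into the
    term. This carries normal forms from [V1] over to [V2]. *)
Lemma derived_alg_dual (A : alg2) (t : hypersubst) :
  derived_alg (dual A) t = derived_alg A (mirror t).
Proof.
rewrite /derived_alg; congr Alg2.
by apply/funext => a; apply/funext => b; rewrite /term_op eval_dual.
Qed.

Lemma generated_variety_id (V : set alg2) :
  is_variety V -> generated_variety V = V.
Proof. exact: smallest_id. Qed.

(** Generating from a class that is already a variety adds nothing, so computing the image of [V] is
    enough. *)
Lemma derived_variety_image (V W : set alg2) (s : hypersubst) :
  is_variety W -> [set derived_alg A s | A in V] = W ->
  derived_variety V s = W.
Proof. by move=> varW imW; rewrite /derived_variety imW generated_variety_id. Qed.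

Lemma eq_derived_variety (V : set alg2) (s t : hypersubst) :
  (forall A, V A -> derived_alg A s = derived_alg A t) ->
  derived_variety V s = derived_variety V t.
Proof. by move=> st; congr generated_variety; apply: eq_imagel. Qed.

(** * Equational descriptions of the band varieties *)

Definition val3 (A : Type) (a b c : A) (n : nat) : A :=
  if n is n'.+1 then (if n' is _.+1 then c else b) else a.

Definition assoc_id : identity2 :=
  (App (Var 0) (App (Var 1) (Var 2)), App (App (Var 0) (Var 1)) (Var 2)).

Definition idem_id : identity2 := (App (Var 0) (Var 0), Var 0).

Lemma bandsE : bands = models [set assoc_id; idem_id].
Proof.
apply/seteqP; split=> A.
  by case=> opA opxx e [->|->] v /=; [rewrite opA | rewrite opxx].
move=> AE; split.
  by move=> a b c; apply: (AE assoc_id (or_introl erefl) (val3 a b c)).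
by move=> a; apply: (AE idem_id (or_intror erefl) (val3 a a a)).
Qed.

Lemma is_variety_bandsI (e : identity2) :
  is_variety [set A | bands A /\ satisfies A e].
Proof.
exists ([set assoc_id; idem_id] `|` [set e]); rewrite bandsE.
apply/seteqP; split=> A.
  by case=> AE Ae d [|->] //; apply: AE.
by move=> AE; split=> [d dE|]; apply: AE; [left | right].
Qed.

Lemma V1_variety : is_variety V1.
Proof. exact: is_variety_bandsI. Qed.

Lemma V2_variety : is_variety V2.
Proof. exact: is_variety_bandsI. Qed.

Lemma V1P (A : alg2) :
  V1 A <-> bands A /\ forall a b c : A, op (op c a) b = op (op c b) a.
Proof.
split=> -[bA AE]; split=> //; last by move=> v; apply: AE.
by move=> a b c; apply: (AE (val3 a b c)).
Qed.

Lemma V2P (A : alg2) :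
  V2 A <-> bands A /\ forall a b c : A, op (op b a) c = op (op a b) c.
Proof.
split=> -[bA AE]; split=> //; last by move=> v; apply: AE.
by move=> a b c; apply: (AE (val3 a b c)).
Qed.

Lemma bands_dual (A : alg2) : bands A -> bands (dual A).
Proof. by case=> opA opxx; split=> [a b c|a]; [apply/esym/opA | apply: opxx]. Qed.

(** Up to bracketing, reading both sides of [zxy = zyx] backwards gives [yxz = xyz]. *)
Lemma V2_dual (A : alg2) : V1 A -> V2 (dual A).
Proof.
case/V1P=> bA AE; apply/V2P; split; first exact: bands_dual.
by case: bA => opA _ a b c; rewrite /= /term_op /= !opA; apply: AE.
Qed.

Lemma V1_dual (A : alg2) : V2 A -> V1 (dual A).
Proof.
case/V2P=> bA AE; apply/V1P; split; first exact: bands_dual.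
by case: bA => opA _ a b c; rewrite /= /term_op /= !opA; apply: AE.
Qed.

Lemma derived_V1_sigma4 : derived_variety V1 sigma4 = V2.
Proof.
apply: derived_variety_image V2_variety _; apply/seteqP; split=> [_ [A VA <-]|A VA].
  exact: V2_dual.
(* As [dual] is an involution, the opposite of [A] is a preimage of [A]. *)
by exists (dual A); [exact: V1_dual | exact: dualK].
Qed.

Lemma derived_V2_sigma4 : derived_variety V2 sigma4 = V1.
Proof.
apply: derived_variety_image V1_variety _; apply/seteqP; split=> [_ [A VA <-]|A VA].
  exact: V1_dual.
by exists (dual A); [exact: V2_dual | exact: dualK].
Qed.

Lemma derived_variety_xy (V : set alg2) :
  is_variety V -> derived_variety V term_xy = V.
Proof.
move=> varV; apply: derived_variety_image => //.
by rewrite (eq_imagel (fun A _ => derived_alg_xy A)) image_id.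
Qed.

(** * Left zero and right zero bands *)

Definition left_zero : set alg2 := [set A : alg2 | forall a b : A, op a b = a].
Definition right_zero : set alg2 := [set A : alg2 | forall a b : A, op a b = b].

Lemma left_zero_variety : is_variety left_zero.
Proof.
exists [set (App (Var 0) (Var 1), Var 0)]; apply/seteqP; split=> A.
  by move=> Al _ -> v; apply: Al.
by move=> AE a b; apply: (AE _ erefl (val3 a b b)).
Qed.

Lemma right_zero_variety : is_variety right_zero.
Proof.
exists [set (App (Var 0) (Var 1), Var 1)]; apply/seteqP; split=> A.
  by move=> Al _ -> v; apply: Al.
by move=> AE a b; apply: (AE _ erefl (val3 a b b)).
Qed.

Lemma left_zero_V1 : left_zero `<=` V1.
Proof.
by move=> A Al; apply/V1P; split=> [|a b c]; [split=> [a b c|a] |]; rewrite !Al.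
Qed.

Lemma right_zero_V2 : right_zero `<=` V2.
Proof.
by move=> A Al; apply/V2P; split=> [|a b c]; [split=> [a b c|a] |]; rewrite !Al.
Qed.

Definition bool_alg (o : bool -> bool -> bool) : alg2 := Alg2 o (inhabits true).

Lemma right_zero_not_V1 : ~ (right_zero `<=` V1).
Proof.
move=> /(_ (bool_alg (fun _ => id)) (fun _ _ => erefl))/V1P[_].
(* For the second projection, [zxy] is [y] and [zyx] is [x], so any [x] and [y] that differ refute
   the law. *)
by move=> /(_ true false true).
Qed.

Lemma left_zero_not_V2 : ~ (left_zero `<=` V2).
Proof.
move=> /(_ (bool_alg (fun a _ => a)) (fun _ _ => erefl))/V2P[_].
by move=> /(_ true false true).
Qed.

(** The two-element meet semilattice separates the classes: it lies in [V1], but its product is not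
    the first projection. *)
Lemma left_zero_neq_V1 : left_zero <> V1.
Proof.
move=> E; have : V1 (bool_alg andb).
  apply/V1P; split; first by split=> [[] [] []|[]].
  by case=> [] [] [].
by rewrite -E => /(_ true false).
Qed.

Lemma right_zero_neq_V2 : right_zero <> V2.
Proof.
move=> E; have : V2 (bool_alg andb).
  apply/V2P; split; first by split=> [[] [] []|[]].
  by case=> [] [] [].
by rewrite -E => /(_ false true).
Qed.

(** Deriving by [x] forgets the operation and keeps only the carrier. Since every nonempty set
    carries an algebra of [V], all left zero bands arise. *)
Lemma derived_variety_x (V : set alg2) :
  (forall A : alg2, exists o : A -> A -> A, V (Alg2 o (carrier_inhabited A))) ->
  derived_variety V (Var ord0) = left_zero.
Proof.
move=> fullV; apply: derived_variety_image left_zero_variety _.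
apply/seteqP; split=> [_ [A _ <-] //|A Al].
have [o Vo] := fullV A; exists (Alg2 o (carrier_inhabited A)) => //.
(* The derived algebra computes to the first projection; it remains to identify [A] with that
   algebra. *)
transitivity (Alg2 (fun a _ : A => a) (carrier_inhabited A)) => //.
case: A Al {o Vo} => T o i Al; congr Alg2.
by apply/funext => a; apply/funext => b; rewrite [RHS]Al.
Qed.

Lemma derived_variety_y (V : set alg2) :
  (forall A : alg2, exists o : A -> A -> A, V (Alg2 o (carrier_inhabited A))) ->
  derived_variety V (Var ord_max) = right_zero.
Proof.
move=> fullV; apply: derived_variety_image right_zero_variety _.
apply/seteqP; split=> [_ [A _ <-] //|A Ar].
have [o Vo] := fullV A; exists (Alg2 o (carrier_inhabited A)) => //.
transitivity (Alg2 (fun _ b : A => b) (carrier_inhabited A)) => //.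
case: A Ar {o Vo} => T o i Ar; congr Alg2.
by apply/funext => a; apply/funext => b; rewrite [RHS]Ar.
Qed.

Lemma V1_carriers (A : alg2) :
  exists o : A -> A -> A, V1 (Alg2 o (carrier_inhabited A)).
Proof. by exists (fun a _ => a); apply: left_zero_V1. Qed.

Lemma V2_carriers (A : alg2) :
  exists o : A -> A -> A, V2 (Alg2 o (carrier_inhabited A)).
Proof. by exists (fun _ b => b); apply: right_zero_V2. Qed.

(** * Normal forms of binary terms *)

Variant normal_hypersubst : hypersubst -> Prop :=
| NormalX : normal_hypersubst (Var ord0)
| NormalY : normal_hypersubst (Var ord_max)
| NormalXY : normal_hypersubst term_xy
| NormalYX : normal_hypersubst sigma4.

(** By induction on the term: the four forms are closed under products modulo the laws of [V1]. The
    form is chosen before [A], so that it serves the whole variety at once. *)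
Lemma V1_normal_form (s : hypersubst) :
  exists2 n, normal_hypersubst n &
    forall A, V1 A -> forall a b : A, term_op s a b = term_op n a b.
Proof.
elim: s => [i|s [n nn sn] t [m nm tm]].
  case: i => [[|[|//]] lti]; [exists (Var ord0) | exists (Var ord_max)] => //;
  by constructor.
(* This leaves only the multiplication table of the four normal forms. *)
have reduce k : (forall A, V1 A -> forall a b : A,
      op (term_op n a b) (term_op m a b) = term_op k a b) ->
    forall A, V1 A -> forall a b : A, term_op (App s t) a b = term_op k a b.
  by move=> kE A VA a b; rewrite -kE // -sn // -tm.
(* With products bracketed to the right, the laws [x(xy) = xy] and [x(yx) = xy] suffice to collapse
   every entry of the table. *)
have V1E A : V1 A -> [/\ associative (@op A), idempotent_op (@op A),
    forall a b : A, op a (op a b) = op a b & forall a b : A, op a (op b a) = op a b].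
  case/V1P=> -[opA opxx] AE; split=> // a b; first by rewrite opA opxx.
  by rewrite opA AE opxx.
(* Each of the sixteen witnesses keeps the first letter of the left factor; it is a single variable
   only for [x] times [x] and [y] times [y]. *)
case: nn sn reduce => _; case: nm tm => _ reduce;
  [exists (Var ord0) | exists term_xy | exists term_xy | exists term_xy
  |exists sigma4 | exists (Var ord_max) | exists sigma4 | exists sigma4
  |exists term_xy | exists term_xy | exists term_xy | exists term_xy
  |exists sigma4 | exists sigma4 | exists sigma4 | exists sigma4];
  try (by constructor); apply: reduce => A /V1E[opA opxx xxy xyx] a b;
  by rewrite /term_op /= -?opA ?(opxx, xxy, xyx).
Qed.

Lemma V2_normal_form (s : hypersubst) :
  exists2 n, normal_hypersubst n &
    forall A, V2 A -> derived_alg A s = derived_alg A n.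
Proof.
have [n nn sn] := V1_normal_form (mirror s); exists (mirror n).
  by case: nn; constructor.
(* Writing [A] as the opposite of a member of [V1] mirrors both terms, and [mirror n] returns to
   [n]. *)
move=> A /V1_dual VA; rewrite -[A]dualK.
rewrite derived_alg_dual [RHS]derived_alg_dual mirrorK.
exact/derived_alg_op_eq/sn.
Qed.

(** * Computation of the dimensions *)

Lemma has_dim1 (V U : set alg2) (s : hypersubst) :
  derived_variety V s = U -> U <> V -> U `<=` V ->
  (forall t, exists2 n, normal_hypersubst n &
     derived_variety V t = derived_variety V n) ->
  (forall n, normal_hypersubst n ->
     [\/ derived_variety V n = U, derived_variety V n = V
       | ~ (derived_variety V n `<=` V)]) ->
  has_dim V 1.
Proof.
move=> sU UV sUV nf cases; rewrite /has_dim.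
(* Among the normal forms, the alternatives to [U] are excluded by properness or by inclusion. *)
suff -> : proper_derived_subvarieties V = [set U].
  exact: card_set1.
apply/seteqP; split=> [W [t [-> neqV subV]]|_ ->]; last by exists s.
by have [n nn tn] := nf t; move: neqV subV; rewrite tn; case: (cases n nn).
Qed.

Lemma dim_V1 : has_dim V1 1.
Proof.
apply: (has_dim1 (derived_variety_x V1_carriers)).
- exact: left_zero_neq_V1.
- exact: left_zero_V1.
- move=> t; have [n nn tn] := V1_normal_form t; exists n => //.
  by apply: eq_derived_variety => A VA; apply/derived_alg_op_eq/tn.
move=> n [].
- by constructor 1; apply: derived_variety_x V1_carriers.
- constructor 3; rewrite (derived_variety_y V1_carriers).
  exact: right_zero_not_V1.
- by constructor 2; apply: derived_variety_xy V1_variety.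
(* An inclusion of [V2] in [V1] would put the right zero bands into [V1]. *)
constructor 3; rewrite derived_V1_sigma4 => V21.
by apply: right_zero_not_V1; apply: subset_trans right_zero_V2 V21.
Qed.

(** Left and right exchange roles: the only proper derived subvariety now comes from [y]. *)
Lemma dim_V2 : has_dim V2 1.
Proof.
apply: (has_dim1 (derived_variety_y V2_carriers)).
- exact: right_zero_neq_V2.
- exact: right_zero_V2.
- move=> t; have [n nn tn] := V2_normal_form t; exists n => //.
  exact: eq_derived_variety.
move=> n [].
- constructor 3; rewrite (derived_variety_x V2_carriers).
  exact: left_zero_not_V2.
- by constructor 1; apply: derived_variety_y V2_carriers.
- by constructor 2; apply: derived_variety_xy V2_variety.
constructor 3; rewrite derived_V2_sigma4 => V12.
by apply: left_zero_not_V2; apply: subset_trans left_zero_V1 V12.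
Qed.

Theorem theorem4p4 :
  (derived_variety V1 sigma4 = V2 /\ derived_variety V2 sigma4 = V1) /\
  (has_dim V1 1 /\ has_dim V2 1).
Proof.
split; split.
- exact: derived_V1_sigma4.
- exact: derived_V2_sigma4.
- exact: dim_V1.
- exact: dim_V2.
Qed.
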